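(* For $n\ge3$, the normalized volume of $\mathcal{P}_{K_1*C_n}$ equals $(1-\sqrt3)^n+(1+\sqrt3)^n$ if $n$ is odd and $(1-\sqrt3)^n+(1+\sqrt3)^n-2$ if $n$ is even.
   Context: $K_1*C_n$ is the graph with vertices $c,v_1,\dots,v_n$ and edges $\{v_i,v_{i+1}\}$ (indices mod $n$) and $\{c,v_i\}$. For a connected graph $H=(V,E)$, $\mathcal{P}_H:=\mathrm{conv}\{\pm(\mathbf{e}_u-\mathbf{e}_v):\{u,v\}\in E\}\subset\mathbb{R}^V$ is full-dimensional in $\{x:\sum_vx_v=0\}$ of dimension $d=|V|-1$; its normalized volume is $d!$ times its volume with respect to the lattice $\mathbb{Z}^V\cap\{x:\sum_vx_v=0\}$. *)

(* Defs.v *)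
From HB Require Import structures.
From mathcomp Require Import all_boot all_order all_algebra.
From mathcomp Require Import all_classical all_reals all_analysis.

Set Implicit Arguments.
Unset Strict Implicit.
Unset Printing Implicit Defensive.

Import Order.TTheory GRing.Theory Num.Theory.

Local Open Scope classical_set_scope.
Local Open Scope ring_scope.

Definition K1 : rel unit := fun _ _ => false.

Definition cycle_graph (n : nat) : rel 'I_n :=
  fun i j => (j == ordS i) || (i == ordS j).

Definition graph_join (T1 T2 : finType) (e1 : rel T1) (e2 : rel T2) :
    rel (T1 + T2)%type :=
  fun x y => match x, y with
             | inl u, inl v => e1 u v
             | inr u, inr v => e2 u v
             | _, _ => true
             end.

Definition wheel (n : nat) : rel (unit + 'I_n)%type :=
  graph_join K1 (@cycle_graph n).

Arguments wheel n : clear implicits.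

Lemma wheel_sym n : symmetric (wheel n).
Proof. by move=> [[]|i] [[]|j] //=; rewrite /cycle_graph orbC. Qed.

Lemma wheel_irrefl n : (1 < n)%N -> irreflexive (wheel n).
Proof.
move=> n1 [[]//|i]; rewrite /wheel /= /cycle_graph orbb; apply/negbTE/eqP.
move=> /(congr1 val)/=; have := ltn_ord i; rewrite leq_eqVlt => /orP[/eqP iE|lt].
  by rewrite iE modnn => i0; move: n1; rewrite -iE i0.
by rewrite modn_small// => /eqP; rewrite eqn_leq ltnn andbF.
Qed.

Lemma wheel_connected n (x y : unit + 'I_n) : connect (wheel n) x y.
Proof.
have h (z : unit + 'I_n) : connect (wheel n) (inl tt) z.
  by case: z => [[]|i]; [exact: connect0|exact: connect1].
apply: connect_trans (h y).
by rewrite (sym_connect_sym (@wheel_sym n)) h.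
Qed.

Section polytope.
Variables (R : realType) (V : finType).

Definition unit_vec (v : V) : {ffun V -> R} := [ffun w => (w == v)%:R].

Definition convex_hull (M : lmodType R) (A : set M) : set M :=
  smallest (@convex_set R M) A.

Definition symmetric_edge_polytope (E : rel V) : set {ffun V -> R} :=
  convex_hull [set x | exists u v, E u v /\
    (x = unit_vec u - unit_vec v \/ x = - (unit_vec u - unit_vec v))].

Definition zero_sum_lattice : set {ffun V -> R} :=
  [set x | (forall v, x v \is a Num.int) /\ \sum_v x v = 0].

End polytope.

Definition is_lattice_basis (M : zmodType) (L : set M) (d : nat)
    (b : 'I_d -> M) : Prop :=
  (forall i, L (b i)) /\
  (forall x, L x -> exists! c : {ffun 'I_d -> int}, x = \sum_i b i *~ c i).

Lemma zero_sum_lattice_basis (R : realType) (V : finType) : (0 < #|V|)%N ->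
  exists b : 'I_#|V|.-1 -> {ffun V -> R},
    is_lattice_basis (@zero_sum_lattice R V) b.
Proof.
move=> /card_gt0P[v0 _].
pose f (i : 'I_#|V|.-1) : V := enum_val (cast_ord (esym (cardC1 v0)) i).
have f_neq i : f i != v0 by have := enum_valP (cast_ord (esym (cardC1 v0)) i).
have f_inj : injective f by move=> i j /enum_val_inj/cast_ord_inj.
have f_surj w : w != v0 -> exists i, w = f i.
  move=> wv0; have wA : w \in predC1 v0 by [].
  exists (cast_ord (cardC1 v0) (enum_rank_in wA w)).
  by rewrite /f cast_ord_comp cast_ord_id enum_rankK_in.
pose b i : {ffun V -> R} := unit_vec R (f i) - unit_vec R v0.
have bf i j : b i (f j) = (i == j)%:R.
  by rewrite !ffunE (negbTE (f_neq j)) subr0 (inj_eq f_inj) eq_sym.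
have bv0 i : b i v0 = -1.
  by rewrite !ffunE eqxx eq_sym (negbTE (f_neq i)) sub0r.
have sumf (x : {ffun V -> R}) : \sum_v x v = x v0 + \sum_i x (f i).
  rewrite (bigD1 v0)//=; congr (_ + _).
  have -> : \sum_i x (f i) = \sum_(w in predC1 v0) x w.
    rewrite [RHS]big_enum_val (reindex (cast_ord (cardC1 v0))) /=.
      by apply: eq_bigr => i _; rewrite /f cast_ordK.
    exact/onW_bij/(Bijective (cast_ordK _) (cast_ordKV _)).
  by apply: eq_bigl => w; rewrite inE.
have combE (c : {ffun 'I_#|V|.-1 -> int}) w :
    (\sum_i b i *~ c i) w = \sum_i b i w * (c i)%:~R.
  rewrite sum_ffunE; apply: eq_bigr => i _.
  case: (c i) => k; first by rewrite -!pmulrn ffunMnE mulr_natr.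
  by rewrite NegzE !mulrNz ffunE -!pmulrn ffunMnE mulrN mulr_natr.
have combf (c : {ffun 'I_#|V|.-1 -> int}) j :
    (\sum_i b i *~ c i) (f j) = (c j)%:~R.
  rewrite combE (bigD1 j)//= bf eqxx mul1r big1 ?addr0// => i ij.
  by rewrite bf (negbTE ij) mul0r.
exists b; split=> [i|x [xint xsum]].
  split=> [v|].
    by rewrite !ffunE rpredB// natr_int.
  rewrite sumf bv0 (bigD1 i)//= bf eqxx big1 ?addr0 ?addNr// => j ji.
  by rewrite bf eq_sym (negbTE ji).
exists [ffun i => Num.floor (x (f i))]; split.
  apply/ffunP => w; have [->|/f_surj[j ->]] := eqVneq w v0; last first.
    by rewrite combf ffunE floorK.
  move: xsum; rewrite sumf => /eqP; rewrite addr_eq0 => /eqP ->.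
  rewrite combE -sumrN; apply: eq_bigr => i _.
  by rewrite bv0 mulN1r ffunE floorK.
move=> c xE; apply/ffunP => i; apply/eqP; rewrite -(eqr_int R) ffunE.
by rewrite -combf -xE floorK.
Qed.

Section tuple_product_measure.
Local Open Scope ereal_scope.
Context (disp : measure_display) (T : measurableType disp) (R : realType).
Variables (n : nat) (m1 : {sigma_finite_measure set T -> \bar R})
  (m2 : {sigma_finite_measure set (n.-tuple T) -> \bar R}).

Definition pair_tuple (p : T * n.-tuple T) : n.+1.-tuple T :=
  [the n.+1.-tuple T of p.1 :: p.2].

Lemma measurable_pair_tuple : measurable_fun [set: T * n.-tuple T] pair_tuple.
Proof. by apply: measurable_cons. Qed.

Definition cons_measure : set (n.+1.-tuple T) -> \bar R :=
  pushforward (m1 \x m2) pair_tuple.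

Let cons_measure0 : cons_measure set0 = 0.
Proof. by rewrite /cons_measure /pushforward preimage_set0 measure0. Qed.

Let cons_measure_ge0 A : 0 <= cons_measure A.
Proof. by rewrite /cons_measure /pushforward measure_ge0. Qed.

Let cons_measure_sigma_additive : semi_sigma_additive cons_measure.
Proof.
move=> F mF tF mUF; rewrite /cons_measure /pushforward preimage_bigcup.
have mp := measurable_pair_tuple.
apply: measure_semi_sigma_additive.
- by move=> k; rewrite -[X in measurable X]setTI; exact: mp.
- apply/trivIsetP => /= i j _ _ ij; rewrite -preimage_setI.
  by move/trivIsetP : tF => /(_ _ _ _ _ ij) ->//; rewrite preimage_set0.
- by rewrite -preimage_bigcup -[X in measurable X]setTI; exact: mp.
Qed.

HB.instance Definition _ := isMeasure.Build _ _ _ cons_measure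
  cons_measure0 cons_measure_ge0 cons_measure_sigma_additive.

Let cons_measure_sigma_finite : sigma_finite setT cons_measure.
Proof.
have /sigma_finiteP[F [TF ndF Foo]] := sigma_finiteT m1.
have /sigma_finiteP[G [TG ndG Goo]] := sigma_finiteT m2.
pose g (t : n.+1.-tuple T) : T * n.-tuple T := (thead t, [tuple of behead t]).
have mg : measurable_fun setT g.
  apply/measurable_fun_pairP; split => /=.
    exact: measurable_tnth.
  exact: measurable_behead.
exists (fun k => g @^-1` (F k `*` G k)).
  rewrite -preimage_bigcup predeqE => t; split => // _.
  have [k _ Fk] : (\bigcup_i F i) (g t).1 by rewrite -TF.
  have [l _ Gl] : (\bigcup_i G i) (g t).2 by rewrite -TG.
  exists (maxn k l) => //; split.
  - by move: Fk; exact/subsetPset/ndF/leq_maxl.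
  - by move: Gl; exact/subsetPset/ndG/leq_maxr.
move=> k; have [mF Fkoo] := Foo k; have [mG Gkoo] := Goo k.
have mFG : measurable (F k `*` G k) by exact: measurableX.
split; first by rewrite -[X in measurable X]setTI; exact: mg.
rewrite /cons_measure /pushforward -comp_preimage.
rewrite (_ : g \o pair_tuple = id) ?preimage_id.
  by rewrite product_measure1E// lte_mul_pinfty// ge0_fin_numE.
apply/funext => -[x t]; rewrite /g /pair_tuple /=; congr pair.
by apply/val_inj.
Qed.

HB.instance Definition _ := Measure_isSigmaFinite.Build _ _ _ cons_measure
  cons_measure_sigma_finite.

End tuple_product_measure.

Section lebesgue_tuple.
Local Open Scope ereal_scope.
Context (R : realType).
Notation mR := (measurableTypeR R).

Definition dirac_nil : set (0.-tuple mR) -> \bar R := dirac [tuple].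

HB.instance Definition _ := Measure.on dirac_nil.

Let dirac_nil_sigma_finite : sigma_finite setT dirac_nil.
Proof.
apply: fin_num_fun_sigma_finite; first by rewrite measure0.
by move=> A _; rewrite /dirac_nil diracE.
Qed.

HB.instance Definition _ := Measure_isSigmaFinite.Build _ _ _ dirac_nil
  dirac_nil_sigma_finite.

Fixpoint lebesgue_tuple (d : nat) :
    {sigma_finite_measure set (d.-tuple mR) -> \bar R} :=
  match d with
  | 0 => dirac_nil
  | d'.+1 => cons_measure (@lebesgue_measure R) (lebesgue_tuple d')
  end.

Lemma lebesgue_tuple_box d (A : 'I_d -> set mR) :
  (forall i, measurable (A i)) ->
  lebesgue_tuple d [set t | forall i, A i (tnth t i)] =
  \prod_(i < d) lebesgue_measure (A i).
Proof.
elim: d A => [|d IH] A mA.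
  by rewrite big_ord0 /= /dirac_nil diracE mem_set// => -[].
rewrite big_ord_recl -IH //= /cons_measure /pushforward.
rewrite [X in _ X = _](_ : _ =
  A ord0 `*` [set t | forall i, A (lift ord0 i) (tnth t i)]); last first.
  apply/seteqP; split => -[x t] /= h.
    split => [|i]; first exact: (h ord0).
    by have := h (lift ord0 i); rewrite tnthS.
  by move=> i; case: (unliftP ord0 i) => [j|] -> //; [rewrite tnthS; exact: h.2|exact: h.1].
rewrite product_measure1E//.
rewrite [X in measurable X](_ : _ =
  \bigcap_(i in [set: 'I_d]) ((@tnth d mR) ^~ i @^-1` A (lift ord0 i))).
  apply: fin_bigcap_measurable => // i _.
  by rewrite -[X in measurable X]setTI; exact: measurable_tnth.
by apply/seteqP; split => t /= h i; [move=> _; exact: h|exact: h].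
Qed.

End lebesgue_tuple.

(* Volume normalized by the lattice with basis [b]: the coordinates in [b] turn
   that lattice into Z^d, and another choice of basis changes them by an element
   of GL_d(Z), which preserves Lebesgue measure. *)
Definition normalized_volume (R : realType) (M : lmodType R) (d : nat)
    (b : 'I_d -> M) (P : set M) : \bar R :=
  ((d`!)%:R%:E * lebesgue_tuple R d
     [set t | P (\sum_(i < d) (tnth t i : R) *: b i)%R])%E.

(* Main.v *)
(** Leaving out the coordinate of the hub identifies [k P] with the vectors [x] of
    R^n that are demands of a flow of cost at most [k] on the wheel.  Longer routes
    go through the hub, so a cheapest flow only ships along rim edges joining a
    source to a sink, and it is found greedily around the rim: the residue of a
    vertex is what its predecessor could not absorb.  The greedy choices are
    recorded by a cyclic word; each admissible word yields one unimodular cone, so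
    an integer vector [x] corresponds to a word [w] and [c] in N^n with cost
    [\sum c], uniquely so when [c] is positive.  Counting the lattice points of
    [k P], in any lattice basis, by pairs [(w, c)] squeezes the volume of [P] between
    [#words * 'C(k - O(1), n) / k^n] and [#words * 'C(k + O(1), n) / k^n].  The words
    are the closed walks of a transfer matrix whose nonzero eigenvalues are
    [1 + sqrt 3] and [1 - sqrt 3], except for the two alternating words that exist
    when [n] is even. *)

Require Import Defs.
From mathcomp Require Import all_boot all_order all_algebra.
From mathcomp Require Import all_classical all_reals all_analysis.
From mathcomp Require Import zify ring lra.

Set Implicit Arguments.
Unset Strict Implicit.
Unset Printing Implicit Defensive.

Import Order.TTheory GRing.Theory Num.Theory numFieldNormedType.Exports.

Local Open Scope ring_scope.

(** * Cyclic words and the vectors they code *)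

(* A letter is the sign of a vertex and the way it treats the residue of its
   predecessor: [None] if both have the same sign; if the signs are opposite,
   [Some true] when the vertex uses up that residue and has a rest of its own,
   [Some false] when the residue saturates the vertex. *)
Definition letter := (bool * option bool)%type.

(** Two letters [Some false] in a row are excluded: a saturated vertex has no residue left with
    which to saturate the next one. *)
Definition follows (a b : letter) : bool :=
  (if b.2 is None then b.1 == a.1 else b.1 != a.1) &&
  ~~ ((a.2 == Some false) && (b.2 == Some false)).

Definition closed_word n (w : {ffun 'I_n -> letter}) : bool :=
  [forall i, follows (w i) (w (ordS i))].

(** A closed word of this kind alternates in sign and sends [c], up to sign, to the sums of cyclic
    neighbours. Adding 1 and -1 in turn to [c] preserves these sums, so the cone is degenerate and
    the word is discarded. *)
Definition all_partial n (w : {ffun 'I_n -> letter}) : bool :=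
  [forall i, (w i).2 == Some true].

Definition valid_word n (w : {ffun 'I_n -> letter}) : bool :=
  closed_word w && ~~ all_partial w.

Definition sgz_of (s : bool) : int := if s then 1 else -1.

Section coding.
Variables (n : nat) (w : {ffun 'I_n -> letter}) (c : 'I_n -> nat).

Definition absorbed i := (w i).2 == Some false.

(* [resid i] is what is left at [i] after receiving from its predecessor, and
   [ship i] the part of it that goes to [ordS i]; the rest goes to the hub. *)
Definition resid i : nat :=
  ((if absorbed i then 0 else c i) + (if absorbed (ordS i) then c (ordS i) else 0))%N.

Definition ship i : nat :=
  match (w (ordS i)).2 with
  | None => 0
  | Some true => resid i
  | Some false => c (ordS i)
  end.

Definition demand i : int := sgz_of (w i).1 * (resid i + ship (ord_pred i))%N%:Z.

(** Each [c i] is counted once, at [i] or, if [i] is absorbed, at its predecessor. Hence the cost of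
    the coded flow is the sum of [c]. *)
Lemma sum_resid : (\sum_i resid i = \sum_i c i)%N.
Proof.
rewrite big_split /= addnC.
rewrite -(reindex_inj (@ordS_inj n) (P := xpredT) (F := fun i => if absorbed i then c i else 0%N)) /=.
by rewrite -big_split; apply: eq_bigr => i _; case: absorbed => /=; lia.
Qed.

Hypothesis cw : closed_word w.

Lemma closed_word_resid0 i : absorbed i -> resid i = 0%N.
Proof.
move=> zi; move/forallP: cw => /(_ i)/andP[_].
by rewrite /resid zi -/(absorbed i) -/(absorbed (ordS i)) zi /= => /negbTE ->.
Qed.

Lemma ship_le_resid i : (ship i <= resid i)%N.
Proof.
rewrite /ship; move/forallP: cw => /(_ i)/andP[_].
rewrite -/(absorbed i) -/(absorbed (ordS i)) /resid /absorbed.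
by case: (w (ordS i)).2 => [[]|] //=; rewrite andbT => /negbTE ->; rewrite leq_addl.
Qed.

(** Conservation of flow at [i]: a nonzero shipment joins opposite signs, so what [i] receives adds
    to its demand in absolute value. *)
Lemma demandE i :
  demand i = sgz_of (w i).1 * (resid i)%:Z
             - sgz_of (w (ord_pred i)).1 * (ship (ord_pred i))%:Z.
Proof.
rewrite /demand /ship ord_predK; move/forallP: cw => /(_ (ord_pred i))/andP[+ _].
rewrite ord_predK.
case: (w i) => s [z|] /=; last by rewrite PoszD mulr0 subr0 addr0.
by case: s; case: (w (ord_pred i)).1 => //= _; case: z; rewrite /sgz_of; lia.
Qed.

End coding.

Lemma ordS_cover n (i j : 'I_n) : exists2 k, (k < n)%N & j = iter k (@ordS n) i.
Proof.
have it k : val (iter k (@ordS n) i) = ((i + k) %% n)%N.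
  elim: k => [|k IH] /=; first by rewrite addn0 modn_small.
  by rewrite IH -addn1 modnDml addn1 addnS.
have n0 : (0 < n)%N by case: n i {j it} => // -[].
exists ((j + (n - i)) %% n)%N; first by rewrite ltn_mod.
apply/val_inj; rewrite it modnDmr addnCA subnKC ?modnDr ?modn_small//.
exact/ltnW.
Qed.

(** Summed over the cycle, both sides of the hypothesis agree, so every inequality is an
    equality. *)
Lemma cyclic_nonincreasing_const n (h : 'I_n -> nat) :
  (forall i, h (ordS i) <= h i)%N -> forall i j, h i = h j.
Proof.
move=> hS; have hE i : h (ordS i) = h i.
  have [_] := leqif_sum (fun i (_ : true) => leqif_eq (hS i)).
  rewrite -(reindex_inj (@ordS_inj n) (P := xpredT) (F := h)) eqxx.
  by move/esym/forall_inP => /(_ i isT)/eqP.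
move=> i j; have [k _ ->] := ordS_cover i j.
by elim: k => //= k ->; rewrite hE.
Qed.


Section demand_inj.
Variable n : nat.
Implicit Types (v : {ffun 'I_n -> letter}) (d : 'I_n -> nat).

(** For positive entries the letter at [j] can be read off its sign relative to [i] and whether its
    residue vanishes. *)
Lemma positive_step v d i : closed_word v -> (forall i, 0 < d i)%N ->
  let j := ordS i in
  [\/ [/\ v j = ((v i).1, None), ship v d i = 0%N & (0 < resid v d j)%N],
      [/\ v j = (~~ (v i).1, Some true), ship v d i = resid v d i
        & (0 < resid v d j)%N]
    | [/\ v j = (~~ (v i).1, Some false), ship v d i = d j, resid v d j = 0%N
        & (d j < resid v d i)%N]].
Proof.
move=> cv d0 j; have Zj := closed_word_resid0 d cv (i := j).
have Rj : ~~ absorbed v j -> (0 < resid v d j)%N.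
  by rewrite /resid => /negbTE ->; rewrite ltn_addr.
have Ri : ~~ absorbed v i -> absorbed v j -> (d j < resid v d i)%N.
  by rewrite /resid -/j => /negbTE -> ->; have := d0 i; lia.
move/forallP: cv => /(_ i)/andP[]; rewrite -/j -/(absorbed v i) -/(absorbed v j).
rewrite /ship -/j; have aj : absorbed v j = ((v j).2 == Some false) by [].
move: Zj Rj Ri; rewrite aj.
case: (v j) => s [[]|] /= Zj Rj Ri sE; rewrite ?eqxx ?andbT /=.
- by move=> _; apply: Or32; split; rewrite ?Rj//; case: s (v i).1 sE => [] [].
- move=> zi; apply: Or33; split; rewrite ?Zj ?Ri//.
  by case: s (v i).1 sE => [] [].
- by move=> _; apply: Or31; split; rewrite ?Rj// (eqP sE).
Qed.

Lemma sgz_of_inj s s' (a b : nat) : (0 < a)%N -> (0 < b)%N ->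
  sgz_of s * a%:Z = sgz_of s' * b%:Z -> s = s' /\ a = b.
Proof. by case: s; case: s'; rewrite /sgz_of; split; lia. Qed.

(* The residues of two codes of the same vector differ, in absolute value, by a
   cyclically nonincreasing function, which drops strictly to [0] at a letter
   that is not partial. *)
Lemma demand_inj v v' d d' : valid_word v -> valid_word v' ->
  (forall i, 0 < d i)%N -> (forall i, 0 < d' i)%N ->
  (forall i, demand v d i = demand v' d' i) ->
  v = v' /\ (forall i, d i = d' i).
Proof.
move=> /andP[cv pv] /andP[cv' pv'] d0 d0' E.
have {E}E i : (v (ordS i)).1 = (v' (ordS i)).1 /\
    (resid v d (ordS i) + ship v d i = resid v' d' (ordS i) + ship v' d' i)%N.
  have := E (ordS i); rewrite /demand ordSK; apply: sgz_of_inj.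
  - have := d0 (ordS i).
    by case: (positive_step i cv d0) => -[? ? ? *]; lia.
  - have := d0' (ordS i).
    by case: (positive_step i cv' d0') => -[? ? ? *]; lia.
have Es i : (v i).1 = (v' i).1 by rewrite -(ord_predK i) (E _).1.
have Er i : resid v d i = resid v' d' i.
  (* Truncated subtraction in both directions gives the distance of the two residues. *)
  pose h i := (resid v d i - resid v' d' i + (resid v' d' i - resid v d i))%N.
  have hstep j : (h (ordS j) <= h j)%N /\
      ((v (ordS j)).2 != Some true -> h (ordS j) = 0%N \/ h (ordS j) < h j)%N.
    have [E1 E2] := E j; have := Es j; have := d0 (ordS j); have := d0' (ordS j).
    move: E1 E2; rewrite /h.
    case: (positive_step j cv d0) => [[-> -> A1]|[-> -> A1]|[-> -> A1 A2]];
    case: (positive_step j cv' d0') => [[E1 -> B1]|[E1 -> B1]|[E1 -> B1 B2]]; move: E1 => /=;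
      case: (v' (ordS j)) => ? ? [-> _] /=; first [by do 2 case: (_ .1)
      | by split=> //; lia].
  have hc := @cyclic_nonincreasing_const n h (fun j => (hstep j).1).
  (* Constancy of [h] forbids a strict drop at a letter that is not partial, so [h] vanishes there
     and hence everywhere. *)
  move: pv; rewrite negb_forall => /existsP[k]; rewrite -(ord_predK k) => kP.
  have := (hstep (ord_pred k)).2 kP; have := hc (ord_pred k) (ordS (ord_pred k)).
  have := hc i (ordS (ord_pred k)); rewrite /h; lia.
have E' i : (v (ordS i) = v' (ordS i)) /\
    ((v (ordS i)).2 = Some false -> d (ordS i) = d' (ordS i)).
  have [E1 E2] := E i; have := Es i; have := d0 (ordS i); have := d0' (ordS i).
  have := Er i; have := Er (ordS i); move: E1 E2.
  case: (positive_step i cv d0) => [[-> -> A1]|[-> -> A1]|[-> -> A1 A2]];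
  case: (positive_step i cv' d0') => [[E1 -> B1]|[E1 -> B1]|[E1 -> B1 B2]]; move: E1 => /=;
      case: (v' (ordS i)) => ? ? [-> ->] /=; first [by do 2 case: (_ .1) | lia
      | by split=> //; try congr pair; lia].
have Ev : v = v' by apply/ffunP => i; rewrite -(ord_predK i) (E' _).1.
split=> // i; have := Er i; rewrite /resid -Ev.
have H j : absorbed v j -> d j = d' j.
  by rewrite -(ord_predK j) => /eqP; exact: (E' _).2.
case: ifP => [/H//|_]; case: ifP => [/H ->|_]; lia.
Qed.

End demand_inj.

(** * Every integer vector has a code *)

(* The signed residue of a vertex of demand [x] whose predecessor has signed
   residue [a]; it is nondecreasing in [a]. *)
Definition carry (x a : int) : int :=
  if 0 <= x then (if 0 <= a then x else if 0 <= x + a then x + a else 0)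
  else (if a <= 0 then x else if x + a <= 0 then x + a else 0).

Lemma carry_le x a b : a <= b -> carry x a <= carry x b.
Proof. by rewrite /carry; do !case: ifP => ?; lia. Qed.

Lemma carry_bound x a : - `|x| <= carry x a <= `|x|.
Proof. by rewrite /carry; do !case: ifP => ?; lia. Qed.

Section carry_fixpoint.
Variables (n : nat) (n0 : (0 < n)%N) (x : 'I_n -> int).

(** If moreover [rho i] has the sign of [x i], then [carry] is plain addition at this step. *)
Definition linear_step (rho : 'I_n -> int) i :=
  ((0 <= x (ordS i)) != (0 <= x i)) && (`|rho i| <= `|x (ordS i)|).

(* A prefixpoint of minimal sum is a fixpoint (Knaster-Tarski); when all steps
   are linear it could be lowered by 1 everywhere unless a nonnegative entry
   carries 0. *)
Lemma carry_fixpoint_below (N : nat) (rho : 'I_n -> int) :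
  (forall i, carry (x (ordS i)) (rho i) <= rho (ordS i)) ->
  \sum_i (rho i + `|x i|) < N%:Z ->
  exists2 rho' : 'I_n -> int,
    forall i, rho' (ordS i) = carry (x (ordS i)) (rho' i)
    & ~ (forall i, linear_step rho' i /\ (0 <= x i -> 0 < rho' i)).
Proof.
elim: N rho => [|N IH] rho pre.
  rewrite ltNge sumr_ge0// => i _; have := pre (ord_pred i).
  by have := carry_bound (x i) (rho (ord_pred i)); rewrite ord_predK; lia.
move=> sumN.
have [/existsP[i ilt]|] := boolP [exists i, carry (x (ordS i)) (rho i) < rho (ordS i)].
  (* Lowering one entry to its carried value keeps a prefixpoint, by monotonicity of [carry], and
     decreases the sum. *)
  pose rho' j := if j == ordS i then carry (x (ordS i)) (rho i) else rho j.
  have le' j : rho' j <= rho j by rewrite /rho'; case: eqP => // ->; exact/ltW.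
  apply: (IH rho').
    move=> j; apply: le_trans (carry_le (x (ordS j)) (le' j)) _.
    by rewrite /rho'; case: eqP => [/ordS_inj ->|_]; rewrite ?pre.
  have : \sum_i (rho' i + `|x i|) < \sum_i (rho i + `|x i|).
    rewrite (bigD1 (ordS i))//= [ltRHS](bigD1 (ordS i))//= ltr_leD//.
      by rewrite /rho' eqxx; lia.
    by apply: ler_sum => j _; rewrite lerD2r.
  by lia.
rewrite negb_exists => /forallP nlt.
have fixr i : rho (ordS i) = carry (x (ordS i)) (rho i).
  by have := nlt i; have := pre i; lia.
have [all_lin|] := pselect (forall i, linear_step rho i /\ (0 <= x i -> 0 < rho i)); last first.
  by exists rho.
apply: (IH (fun i => rho i - 1)).
  move=> i; have [/andP[+ +] pi] := all_lin i; have [_ pj] := all_lin (ordS i).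
  have : x i < 0 -> rho i <= 0.
    by rewrite -(ord_predK i) fixr /carry; do !case: ifP => ?; lia.
  by move: pi pj (fixr i); rewrite /carry; do !case: ifP => ?; lia.
have : \sum_i (rho i - 1 + `|x i|) = \sum_i (rho i + `|x i|) - n%:Z.
  rewrite (eq_bigr (fun i => rho i + `|x i| - 1)); last by move=> i _; rewrite addrAC.
  by rewrite sumrB sumr_const card_ord natz.
by lia.
Qed.


(** The descent starts from the upper bound [|x i|] of all carries. The side condition will provide
    a letter that is not partial. *)
Lemma carry_fixpoint : exists2 rho : 'I_n -> int,
  forall i, rho (ordS i) = carry (x (ordS i)) (rho i)
  & ~ (forall i, linear_step rho i /\ (0 <= x i -> 0 < rho i)).
Proof.
apply: (@carry_fixpoint_below (absz (\sum_i (`|x i| + `|x i|))).+1 (fun i => `|x i|)).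
  by move=> i; have /andP[] := carry_bound (x (ordS i)) `|x i|.
by move=> /=; set S := bigop _ _ _; lia.
Qed.

End carry_fixpoint.

Lemma code_exists n (n1 : (1 < n)%N) (x : 'I_n -> int) :
  exists2 w, valid_word w & exists c : 'I_n -> nat, forall i, demand w c i = x i.
Proof.
have [rho fixr nlin] := carry_fixpoint (ltnW n1) x.
pose s i := 0 <= x i; pose u i := absz (x i); pose r i := absz (rho i).
have rho_sign i : if s i then 0 <= rho i <= x i else x i <= rho i <= 0.
  by rewrite -(ord_predK i) fixr /s /carry; do !case: ifP => ?; lia.
have r_same i : s (ordS i) = s i -> r (ordS i) = u (ordS i).
  have := rho_sign i; rewrite /r /u fixr /carry /s => + ->.
  by case: ifP => ? ?; do !case: ifP => ?; lia.
have r_flip i : s (ordS i) = ~~ s i -> r (ordS i) = (u (ordS i) - r i)%N.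
  have := rho_sign i; rewrite /r /u fixr /carry /s.
  by case: (lerP 0 (x i)); case: (lerP 0 (x (ordS i))) => //= *; do !case: ifP => ?; lia.
(* [z] marks the vertices declared saturated. In a tie between residue and demand both declarations
   are possible; the last condition excludes the all-partial word. *)
suff [z [zP nzP zz ex]] : exists z : pred 'I_n, [/\
    forall i, z (ordS i) -> s (ordS i) = ~~ s i /\ (u (ordS i) <= r i)%N,
    forall i, ~~ z (ordS i) -> s (ordS i) = ~~ s i -> (r i <= u (ordS i))%N,
    forall i, ~~ (z i && z (ordS i))
    & exists i, z (ordS i) || (s (ordS i) == s i)].
  pose w := [ffun i => (s i, if s i == s (ord_pred i) then None else Some (~~ z i))].
  (* This solves the definition of [resid] for [c], with [resid] equal to [r]. *)
  pose c i := if z i then u i else (r i - (if z (ordS i) then u (ordS i) else 0))%N.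
  have aE i : absorbed w i = z i.
    rewrite /absorbed ffunE /=; case: ifP => [/eqP|_]; last by case: (z i).
    rewrite -{1 3}(ord_predK i) => sE; apply/esym/negbTE/negP => /zP[].
    by rewrite sE; case: (s _).
  have rE i : resid w c i = r i.
    rewrite /resid !aE /c; have := zz i; case: ifP => /= zi.
      move=> /negbTE ->; have := zP (ord_pred i); rewrite ord_predK => /(_ zi)[].
      by have := r_flip (ord_pred i); rewrite ord_predK => /[apply]; lia.
    by rewrite zi; case zS: (z (ordS i)) => _; [have [_] := zP i zS|]; lia.
  exists w.
    apply/andP; split.
      apply/forallP => i; apply/andP; split; last first.
        by have := zz i; rewrite -!aE.
      by rewrite !ffunE /= ordSK; case: ifP => // ->.
    case: ex => i zi; apply/forallPn; exists (ordS i); rewrite !ffunE /= ordSK.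
    by case: ifP => [//|sE]; move: zi; rewrite sE orbF => ->.
  exists c => i; rewrite /demand rE -(ord_predK i); set j := ord_pred i.
  have -> : sgz_of (w (ordS j)).1 = if s (ordS j) then 1 else -1 by rewrite ffunE.
  suff -> : (r (ordS j) + ship w c (ord_pred (ordS j)) = u (ordS j))%N.
    by rewrite /s /u; case: ifP; lia.
  rewrite ordSK /ship rE !ffunE /= ordSK; case: eqP => [/r_same|/eqP sE]; first by lia.
  have {}sE : s (ordS j) = ~~ s j by move: sE; do 2 case: (s _).
  have := r_flip j sE; have := zP j; have := nzP j; rewrite /c.
  case: (z (ordS j)) => /=; first by move=> _ /(_ isT)[]; lia.
  by move=> /(_ isT sE); lia.
pose z i := (s i == ~~ s (ord_pred i)) && (u i < r (ord_pred i))%N.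
have [ex|nex] := boolP [exists i, z (ordS i) || (s (ordS i) == s i)].
  exists z; split; last exact/existsP.
  - by move=> i /andP[/eqP]; rewrite ordSK => -> /ltnW.
  - by move=> i; rewrite negb_and ordSK -leqNgt => + sE; rewrite sE eqxx.
  - move=> i; apply/negP => /andP[/andP[/eqP si ui]] /andP[_]; rewrite ordSK.
    have := r_flip (ord_pred i); rewrite ord_predK => /(_ si) ->; lia.
move: nex; rewrite negb_exists => /forallP nex.
have flip i : s (ordS i) = ~~ s i.
  by have := nex i; rewrite negb_or => /andP[_]; case: (s (ordS i)); case: (s i).
have ru i : (r i <= u (ordS i))%N.
  by have := nex i; rewrite negb_or /z ordSK flip eqxx /= -leqNgt => /andP[].
(* Declaring only strict saturation has made every letter partial, so all steps are linear. The side
   condition on [rho] then gives a tie at some [i0], which can be declared saturated instead. *)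
have [i0 si0] : exists i, s i /\ rho i = 0.
  apply: contrapT => ne; apply: nlin => i; split.
    apply/andP; split; first by have := flip i; rewrite /s => ->; case: (_ <= _).
    by have := ru i; rewrite /r /u; lia.
  move=> si; have := rho_sign i; rewrite {1}/s si => /andP[ri _].
  by rewrite lt_neqAle ri andbT; apply/eqP => r0; apply: ne; exists i.
exists (pred1 i0); split=> [i /eqP iE|//|i|].
- split=> //; have := r_flip i (flip i); rewrite iE /r (si0.2); lia.
- apply/negP => /andP[/eqP -> /eqP E].
  (* The wheel has no loops, so [i0] is not its own successor. *)
  by have := wheel_irrefl n1 (inr i0); rewrite /wheel /= /cycle_graph E eqxx.
- by exists (ord_pred i0); rewrite /= ord_predK eqxx.
Qed.

(** * Optimality of the coded flow *)

(* Iterating the system [n] times erases the dependence on the initial value,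
   since every orbit meets the constant equation. *)
Lemma cyclic_system_solvable n (X : Type) (x0 : X) (g : 'I_n -> X -> X) i0 :
  (forall a b, g i0 a = g i0 b) -> exists y, forall i, y i = g i (y (ordS i)).
Proof.
move=> g0; pose G (y : 'I_n -> X) i := g i (y (ordS i)).
have indep k i y y' : (exists2 j, (j < k)%N & i0 = iter j (@ordS n) i) ->
    iter k G y i = iter k G y' i.
  elim: k i => [|k IH] i; first by case.
  case=> -[_ /= E|j jk E]; first by rewrite /G -E; exact: g0.
  by rewrite /= /G (IH (ordS i))//; exists j => //; rewrite E iterSr.
exists (iter n G (fun=> x0)) => i.
by rewrite -[RHS]/(iter n.+1 G (fun=> x0) i) iterSr; apply/indep/ordS_cover.
Qed.

Lemma sum_ordS n (V : nmodType) (F : 'I_n -> V) : \sum_i F (ordS i) = \sum_i F i.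
Proof. by rewrite [RHS](reindex_inj (@ordS_inj n)). Qed.

Section wheel_flow.
Variables (R : realType) (n : nat).

(* [f i] is the flow along the rim edge from [i] to [ordS i], [g i] the one
   along the spoke at [i]. *)
Definition flow_le (x : 'I_n -> R) (k : R) : Prop :=
  exists f g : 'I_n -> R, (forall i, x i = g i + f i - f (ord_pred i)) /\
    \sum_i (`|f i| + `|g i|) <= k.

(** Weak duality: [y] is a potential that is 0 at the hub and changes by at most 1 along each
    edge. *)
Lemma flow_le_dual (x y : 'I_n -> R) k : flow_le x k ->
  (forall i, `|y i| <= 1) -> (forall i, `|y i - y (ordS i)| <= 1) ->
  \sum_i x i * y i <= k.
Proof.
move=> [f [g [xE fgk]]] y1 dy1; apply: le_trans fgk.
have -> : \sum_i x i * y i = \sum_i (f i * (y i - y (ordS i)) + g i * y i).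
  rewrite (eq_bigr (fun i => (f i * y i + g i * y i) - f (ord_pred i) * y i)); last first.
    by move=> i _; rewrite xE; ring.
  rewrite sumrB -[X in _ - X]sum_ordS -sumrB; apply: eq_bigr => i _.
  by rewrite ordSK; ring.
apply: ler_sum => i _; apply: lerD.
  rewrite (le_trans (ler_norm _))// normrM ler_piMr//.
by rewrite (le_trans (ler_norm _))// normrM ler_piMr.
Qed.

Variables (w : {ffun 'I_n -> letter}) (c : 'I_n -> nat).

Lemma normr_sgz_of s (a : R) : `|(sgz_of s)%:~R * a| = `|a|.
Proof. by case: s; rewrite /sgz_of ?mul1r// mulrNz mulN1r normrN. Qed.

Lemma demand_flow : closed_word w ->
  flow_le (fun i => (demand w c i)%:~R) (\sum_i c i)%N%:R.
Proof.
move=> cw; exists (fun i => (sgz_of (w i).1)%:~R * (ship w c i)%:R).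
exists (fun i => (sgz_of (w i).1)%:~R * ((resid w c i)%:R - (ship w c i)%:R)).
split=> [i|].
  by rewrite demandE// rmorphB /= !intrM !pmulrn; ring.
rewrite -(sum_resid w c) natr_sum; apply: ler_sum => i _.
rewrite !normr_sgz_of normr_nat -natrB ?ship_le_resid// normr_nat -natrD.
by rewrite subnKC ?ship_le_resid.
Qed.

(* LP duality: the potential is [0] on a minimum vertex cover of the rim edges
   that join a source and a sink, and the sign of the demand elsewhere. *)
Lemma demand_flow_min k : valid_word w ->
  flow_le (fun i => (demand w c i)%:~R) k -> (\sum_i c i)%N%:R <= k.
Proof.
move=> /andP[cw]; rewrite negb_forall => /existsP[i0 i0P].
(* The equation at the predecessor of [i0] is constant because the letter at [i0] is not partial. *)
have [cov covE] : exists cov : 'I_n -> bool, forall i, cov i =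
    absorbed w i || ((w (ordS i)).2 == Some true) && ~~ cov (ordS i).
  apply: (@cyclic_system_solvable n bool true (fun i b =>
    absorbed w i || ((w (ordS i)).2 == Some true) && ~~ b) (ord_pred i0)) => a b.
  by rewrite ord_predK (negbTE i0P).
pose y i : R := if cov i then 0 else (sgz_of (w i).1)%:~R.
(* The first part makes the potential feasible. The second is complementary slackness: the residue
   lost at a covered [i] is regained as a shipment into an uncovered [ordS i]. *)
have step i : (if (w (ordS i)).1 == (w i).1 then True else cov i || cov (ordS i)) /\
    (ship w c i * (~~ cov (ordS i)) = resid w c i * cov i)%N.
  have Z := closed_word_resid0 c cw (i := i); move/forallP: (cw) => /(_ i)/andP[].
  rewrite -/(absorbed w i) -/(absorbed w (ordS i)) /ship (covE i).
  have : absorbed w (ordS i) -> cov (ordS i) by rewrite (covE (ordS i)) => ->.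
  have -> : absorbed w (ordS i) = ((w (ordS i)).2 == Some false) by [].
  case: (w (ordS i)) => s [[]|] /=; rewrite ?eqxx ?andbT /=.
  - move=> _ /negbTE -> _; split; first by case: (absorbed w i); case: (cov _).
    by case: (absorbed w i) Z => /= [->//|_]; case: (cov _); lia.
  - move=> /(_ isT) -> /negbTE -> /negbTE -> /=.
    by split=> //; lia.
  - by move=> _ -> _; split=> //; case: (absorbed w i) Z => /= [->//|_]; lia.
move=> /(@flow_le_dual _ y)/(_ _ _)/(le_trans _); apply=> [|i|i].
- rewrite -(sum_resid w c) natr_sum.
  rewrite (eq_bigr (fun i => (resid w c i * ~~ cov i + ship w c i * ~~ cov (ordS i))%N%:R)).
    rewrite -natr_sum big_split natrD /=.
    rewrite (reindex_inj (@ord_pred_inj n) (F := fun i => ship w c i * _)%N) /=.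
    rewrite -natrD -big_split natr_sum; apply/ler_sum => i _.
    rewrite /y ord_predK /demand intrM -mulrA /=; case: (cov i) => /=.
      by rewrite !muln0 !mulr0.
    rewrite !muln1 mulrC -!mulrA -intrM.
    by case: (w i).1; rewrite /sgz_of ?mulrNN ?mulr1.
  by move=> i _; congr (_ %:R); rewrite (step i).2; case: (cov i); rewrite /= ?muln0 ?muln1 ?addn0.
- by rewrite /y; case: (cov _); case: (w i).1; rewrite /sgz_of ?normr0 ?mulrNz ?normrN ?normr1.
- have [+ _] := step i; rewrite /y.
  case: (cov i); case: (cov (ordS i)); case: (w i).1; case: (w (ordS i)).1 => //= _;
  by rewrite /sgz_of ?mulrNz ?subrr ?subr0 ?sub0r ?normrN ?normr0 ?normr1.
Qed.

End wheel_flow.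

(** * Counting the words *)

Lemma big_letter (F : letter -> nat) :
  (\sum_x F x = F (true, None) + F (true, Some true) + F (true, Some false)
   + F (false, None) + F (false, Some true) + F (false, Some false))%N.
Proof.
rewrite (bigD1 (true, None))//= (bigD1 (true, Some true))//=.
rewrite (bigD1 (true, Some false))//= (bigD1 (false, None))//=.
rewrite (bigD1 (false, Some true))//= (bigD1 (false, Some false))//= big_pred0.
  by lia.
by case=> [[] [[]|]].
Qed.

Lemma big_follows (F : letter -> nat) a :
  (\sum_(x | follows a x) F x = F (a.1, None) + F (~~ a.1, Some true)
   + (if a.2 is Some false then 0 else F (~~ a.1, Some false)))%N.
Proof.
by rewrite big_mkcond big_letter; case: a => [[] [[]|]] /=; rewrite ?eqxx /=; lia.
Qed.

(** [m] counts the intermediate letters, so this is an entry of the power [m.+1] of the transfer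
    matrix. *)
Fixpoint walks m (a b : letter) : nat :=
  if m is m'.+1 then \sum_(x | follows a x) walks m' x b else follows a b.

Lemma card_path m a b :
  #|[set s : m.-tuple letter | path follows a (rcons s b)]| = walks m a b.
Proof.
elim: m a => [|m IH] a.
  rewrite -sum1dep_card (eq_bigl (fun=> follows a b)); last first.
    by move=> t; rewrite tuple0 /= andbT.
  rewrite /=; case: (follows a b); last by rewrite big_pred0_eq.
  by rewrite sum1_card card_tuple expn0.
rewrite -sum1dep_card.
rewrite (reindex (fun p : letter * m.-tuple letter => [tuple of p.1 :: p.2])) /=.
  rewrite -(pair_big_dep (follows a) (fun x (s : m.-tuple letter) =>
    path follows x (rcons s b)) (fun _ _ => 1%N)) /=.
  by apply: eq_bigr => x _; rewrite sum1dep_card IH.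
exists (fun t => (thead t, [tuple of behead t])) => [[x s] _|t _] /=.
  by congr pair; apply: val_inj.
by rewrite [RHS]tuple_eta; apply: val_inj.
Qed.

Lemma card_closed_word m :
  #|[set w : {ffun 'I_m.+1 -> letter} | closed_word w]| = (\sum_a walks m a a)%N.
Proof.
pose W (p : letter * m.-tuple letter) : {ffun 'I_m.+1 -> letter} :=
  [ffun i => nth p.1 (p.1 :: p.2) (val i)].
have WP p : closed_word (W p) = path follows p.1 (rcons p.2 p.1).
  case: p => a s; apply/forallP/(pathP a) => /= H i.
    rewrite size_rcons size_tuple => im; have := H (Ordinal im); rewrite !ffunE /=.
    rewrite -rcons_cons [nth a (rcons (a :: s) a) i]nth_rcons /= size_tuple im.
    rewrite nth_rcons size_tuple; move: im; rewrite ltnS leq_eqVlt.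
    move=> /orP[/eqP ->|im]; first by rewrite ltnn eqxx modnn.
    by rewrite im modn_small.
  have := ltn_ord i; have := H i; rewrite size_rcons size_tuple !ffunE /=.
  rewrite -rcons_cons [nth a (rcons (a :: s) a) i]nth_rcons /= size_tuple => + im.
  rewrite im => /(_ isT); rewrite nth_rcons size_tuple.
  move: im; rewrite ltnS leq_eqVlt => /orP[/eqP ->|im].
    by rewrite ltnn eqxx modnn.
  by rewrite im modn_small.
rewrite -sum1dep_card (reindex W) /=.
  rewrite (eq_bigl (fun p : letter * m.-tuple letter => path follows p.1 (rcons p.2 p.1))) //.
  rewrite -(pair_big_dep xpredT (fun x (s : m.-tuple letter) =>
    path follows x (rcons s x)) (fun _ _ => 1%N)) /=.
  by apply: eq_bigr => x _; rewrite sum1dep_card card_path.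
exists (fun w => (w ord0, [tuple w (lift ord0 i) | i < m])) => [[a s] _|w _] /=.
  congr pair; first by rewrite ffunE.
  apply: eq_from_tnth => i; rewrite tnth_mktuple ffunE /=.
  by rewrite (tnth_nth a).
apply/ffunP => i; rewrite ffunE /=; case: (unliftP ord0 i) => [j|] -> //=.
by rewrite -[RHS](tnth_mktuple (fun i => w (lift ord0 i)) j) (tnth_nth (w ord0)).
Qed.

(** Only [Some false] restricts what may follow, so these two letters have equal rows in the
    transfer matrix. *)
Lemma walks_partial m s b : walks m (s, Some true) b = walks m (s, None) b.
Proof. by case: m => [|m] //=; rewrite !big_follows. Qed.

Lemma walksS m s t b : walks m.+1 (s, t) b =
  (walks m (s, None) b + walks m (~~ s, None) b
   + (if t is Some false then 0 else walks m (~~ s, Some false) b))%N.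
Proof. by rewrite /= big_follows /= walks_partial. Qed.

(** On the part symmetric under exchange of signs the matrix satisfies [x^2 = 2x + 2]; the
    antisymmetric part dies after two steps, whence the shift of the indices. *)
Lemma walks_recurrence m a b :
  walks m.+4 a b = (2 * walks m.+3 a b + 2 * walks m.+2 a b)%N.
Proof.
pose N k s := walks k (s, None) b; pose Z k s := walks k (s, Some false) b.
have NS k s : N k.+1 s = (N k s + N k (~~ s) + Z k (~~ s))%N by exact: walksS.
have ZS k s : Z k.+1 s = (N k s + N k (~~ s))%N.
  by rewrite /Z walksS addn0.
have E t : (N m.+4 t = 2 * N m.+3 t + 2 * N m.+2 t)%N /\
           (Z m.+4 t = 2 * Z m.+3 t + 2 * Z m.+2 t)%N.
  move: (NS m true) (NS m false) (NS m.+1 true) (NS m.+1 false) (NS m.+2 true)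
    (NS m.+2 false) (ZS m true) (ZS m false) (ZS m.+1 true) (ZS m.+1 false)
    (ZS m.+2 true) (ZS m.+2 false).
  move: (NS m.+3 t) (ZS m.+3 t).
  by case: t => /=; lia.
case: a => s [[]|]; rewrite ?walks_partial; [exact: (E s).1|exact: (E s).2|exact: (E s).1].
Qed.

Lemma closed_walks (R : rcfType) m : (0 < m)%N ->
  (\sum_a walks m a a)%N%:R =
  (1 - Num.sqrt 3) ^+ m.+1 + (1 + Num.sqrt 3) ^+ m.+1 :> R.
Proof.
have q2 : Num.sqrt (3 : R) * Num.sqrt 3 = 3 by rewrite -expr2 sqr_sqrtr.
set q := Num.sqrt 3 in q2 *.
(* The recurrence first yields [walks 4], so the traces for 1, 2 and 3 are all base cases. *)
suff H k : ((\sum_a walks k.+1 a a)%N%:R = (1 - q) ^+ k.+2 + (1 + q) ^+ k.+2) /\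
    ((\sum_a walks k.+2 a a)%N%:R = (1 - q) ^+ k.+3 + (1 + q) ^+ k.+3) /\
    ((\sum_a walks k.+3 a a)%N%:R = (1 - q) ^+ k.+4 + (1 + q) ^+ k.+4).
  by case: m => // k _; have [] := H k.
elim: k => [|k [IH1 [IH2 IH3]]].
  rewrite !big_letter /= !big_follows /=.
  have q3 : q ^+ 2 = 3 by rewrite expr2.
  have q4 : q ^+ 4 = 9 by rewrite (exprM q 2 2) q3; ring.
  split; first by ring: q3.
  by split; ring: q3.
do 2!split=> //; rewrite (eq_bigr (fun a => 2 * walks k.+3 a a + 2 * walks k.+2 a a)%N); last first.
  by move=> a _; rewrite -walks_recurrence.
rewrite big_split -!big_distrr natrD !natrM /= IH3 IH2.
have r1 : (1 - q) ^+ 2 = 2 * (1 - q) + 2 by ring: q2.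
have r2 : (1 + q) ^+ 2 = 2 * (1 + q) + 2 by ring: q2.
rewrite -[k.+4.+1]/(2 + k.+3)%N -[k.+4]/(1 + k.+3)%N !exprD r1 r2.
by ring.
Qed.

Definition alternating n (b : bool) : {ffun 'I_n -> letter} :=
  [ffun i : 'I_n => (b (+) odd i, Some true)].

(** Partial letters flip the sign at each step, so the first sign determines the word, which closes
    up only for even length. *)
Lemma card_all_partial m :
  #|[set w : {ffun 'I_m.+1 -> letter} | closed_word w && all_partial w]|
  = if odd m.+1 then 0%N else 2%N.
Proof.
have alt w : closed_word w -> all_partial w -> w = alternating m.+1 (w ord0).1.
  move=> /forallP cw /forallP pw; apply/ffunP => -[k km].
  elim: k km => [|k IH] km.
    rewrite !ffunE /= addbF (_ : Ordinal km = ord0); last exact: val_inj.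
    by have := pw ord0; case: (w ord0) => s t /= /eqP ->.
  have := cw (Ordinal (ltnW km)); rewrite (_ : ordS _ = Ordinal km); last first.
    by apply: val_inj; rewrite /= modn_small.
  have := pw (Ordinal km); rewrite IH !ffunE /=.
  case: (w (Ordinal km)) => s t /= /eqP -> /andP[+ _] /=.
  by case: s; case: (w ord0).1; case: (odd k).
case: ifP => om.
  apply/eqP; rewrite cards_eq0; apply/eqP/setP => w; rewrite !inE.
  apply/negbTE/negP => /andP[cw pw]; have wE := alt w cw pw.
  move/forallP: cw => /(_ ord_max)/andP[+ _].
  rewrite (_ : ordS ord_max = ord0); last by apply: val_inj; rewrite /= modnn.
  have -> : w ord_max = ((w ord0).1 (+) odd m, Some true) by rewrite {1}wE ffunE.
  have -> : (w ord0).2 = Some true by move/forallP: pw => /(_ ord0)/eqP.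
  by move: om => /= /negbTE ->; rewrite addbF eqxx.
rewrite (_ : [set w | _] = [set alternating m.+1 true; alternating m.+1 false])%SET.
  rewrite cards2; case: eqP => // /ffunP/(_ ord0).
  by rewrite !ffunE.
apply/setP => w; rewrite !inE; apply/andP/orP => [[cw pw]|].
  by rewrite (alt w cw pw); case: (w ord0).1; rewrite eqxx; [left|right].
have H b : closed_word (alternating m.+1 b) /\ all_partial (alternating m.+1 b).
  split; apply/forallP => i; rewrite /follows !ffunE //= andbT odd_mod//=.
  by case: b; case: (odd i).
by case=> /eqP ->; have [] := H true; have [] := H false.
Qed.

Lemma card_valid_word (R : rcfType) n : (1 < n)%N ->
  #|[set w : {ffun 'I_n -> letter} | valid_word w]|%:R =
  (if odd n then (1 - Num.sqrt 3) ^+ n + (1 + Num.sqrt 3) ^+ n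
   else (1 - Num.sqrt 3) ^+ n + (1 + Num.sqrt 3) ^+ n - 2) :> R.
Proof.
case: n => // m; rewrite ltnS => m0; rewrite -closed_walks// -card_closed_word.
set A := [set w | closed_word w]%SET.
have := cardsID [set w | all_partial w]%SET A; have := card_all_partial m.
have -> : [set w : {ffun 'I_m.+1 -> letter} | closed_word w && all_partial w]%SET
    = (A :&: [set w | all_partial w])%SET by apply/setP => w; rewrite !inE.
have -> : [set w : {ffun 'I_m.+1 -> letter} | valid_word w]%SET
    = (A :\: [set w | all_partial w])%SET.
  by apply/setP => w; rewrite !inE andbC.
move=> -> <-; rewrite natrD; case: (odd m.+1); first by rewrite add0r.
by rewrite addrC addKr.
Qed.

(** * Lattice boxes *)

Section grid_boxes.
Local Open Scope classical_set_scope.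
Variable R : realType.

(* The integral of a nonnegative function is a supremum over simple functions,
   so monotonicity does not require measurability. *)
Lemma le_lebesgue_tuple d (A B : set (d.-tuple (measurableTypeR R))) :
  A `<=` B -> (lebesgue_tuple R d A <= lebesgue_tuple R d B)%E.
Proof.
elim: d A B => [|d IH] A B AB.
  rewrite /= /dirac_nil !diracE lee_fin ler_nat.
  by have [/set_mem/AB/mem_set ->|//] := boolP ([tuple] \in A).
rewrite /= /cons_measure /pushforward /product_measure1.
rewrite !ge0_integralTE; [|by move=> x; exact: measure_ge0..].
apply: ereal_sup_le => _ [h hA <-]; exists h => // x.
apply: le_trans (hA x) _; apply: IH => t /=; rewrite /xsection /=.
by rewrite !inE; exact: AB.
Qed.

Variables (d k : nat).
Hypothesis k0 : (0 < k)%N.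

(** The intervals are half-open so that each point lies in exactly one box, the one indexed by its
    floors at scale [k]. *)
Definition grid_box (z : 'I_d -> int) : set (d.-tuple (measurableTypeR R)) :=
  [set t | forall i, `[(z i)%:~R / k%:R, ((z i)%:~R + 1) / k%:R[ (tnth t i)].

Lemma in_grid_box z (t : d.-tuple R) :
  grid_box z t <-> forall i, z i = Num.floor (k%:R * tnth t i).
Proof.
have kR : 0 < k%:R :> R by rewrite ltr0n.
have E i : (`[(z i)%:~R / k%:R, ((z i)%:~R + 1) / k%:R[ (tnth t i) : Prop) =
    ((z i)%:~R <= k%:R * tnth t i < (z i)%:~R + 1) :> Prop.
  by rewrite /= in_itv /= ler_pdivrMr// ltr_pdivlMr// mulrC.
split=> H i; have := H i.
  by rewrite E -(intrD _ _ 1) => /floor_def.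
by rewrite E => ->; rewrite -(intrD _ _ 1) floor_itv.
Qed.

Lemma measurable_grid_box z : measurable (grid_box z).
Proof.
rewrite [X in measurable X](_ : _ = \bigcap_(i in [set: 'I_d])
  ((@tnth d (measurableTypeR R)) ^~ i @^-1`
    `[(z i)%:~R / k%:R, ((z i)%:~R + 1) / k%:R[)).
  apply: fin_bigcap_measurable => // i _.
  by rewrite -[X in measurable X]setTI; exact: measurable_tnth.
by apply/seteqP; split => t /= h i; [move=> _; exact: h|exact: h].
Qed.

Lemma lebesgue_grid_box z : lebesgue_tuple R d (grid_box z) = (k%:R ^- d)%:E.
Proof.
rewrite (@lebesgue_tuple_box R d
  (fun i => `[(z i)%:~R / k%:R, ((z i)%:~R + 1) / k%:R[)); last first.
  by move=> i; exact: measurable_itv.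
rewrite (eq_bigr (fun=> (k%:R^-1)%:E)).
  by rewrite prodEFin prodr_const card_ord exprVn.
move=> i _; rewrite lebesgue_measure_itv /= lte_fin ltr_pM2r ?invr_gt0 ?ltr0n//.
by rewrite ltrDl ltr01 EFinN -EFinD -mulrBl addrAC subrr add0r mul1r.
Qed.

Variables (I : finType) (z : I -> 'I_d -> int) (Q : set (d.-tuple R)).

Let sum_boxes : (\sum_(i \in [set: I]) lebesgue_tuple R d (grid_box (z i)) =
  (#|I|%:R / k%:R ^+ d)%:E)%E.
Proof.
rewrite (_ : [set: I] = [set` enum I]); last first.
  by apply/seteqP; split=> i //= _; rewrite mem_enum.
rewrite -(fsbig_seq _ _ (enum_uniq I)) big_enum /=.
rewrite (eq_bigr (fun=> (k%:R ^- d)%:E)); last first.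
  by move=> i _; exact: lebesgue_grid_box.
by rewrite sumEFin sumr_const mulr_natl.
Qed.

Lemma lebesgue_tuple_le_boxes :
  (forall t, Q t -> exists i, grid_box (z i) t) ->
  (lebesgue_tuple R d Q <= (#|I|%:R / k%:R ^+ d)%:E)%E.
Proof.
move=> QB; rewrite -sum_boxes.
apply: (@le_trans _ _ (lebesgue_tuple R d (\bigcup_(i in [set: I]) grid_box (z i)))).
  by apply: le_lebesgue_tuple => t /QB[i it]; exists i.
apply: content_sub_fsum => //; first exact: finite_finset.
  by move=> i _; exact: measurable_grid_box.
by apply: fin_bigcup_measurable => // i _; exact: measurable_grid_box.
Qed.

Lemma lebesgue_tuple_ge_boxes :
  (forall i j, z i =1 z j -> i = j) -> (forall i t, grid_box (z i) t -> Q t) ->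
  ((#|I|%:R / k%:R ^+ d)%:E <= lebesgue_tuple R d Q)%E.
Proof.
move=> zinj BQ; rewrite -sum_boxes -measure_fin_bigcup; last 3 first.
- exact: finite_finset.
- move=> i j _ _ [t [/in_grid_box ti /in_grid_box tj]].
  by apply: zinj => l; rewrite ti tj.
- by move=> i _; exact: measurable_grid_box.
by apply: le_lebesgue_tuple => t [i _]; exact: BQ.
Qed.

End grid_boxes.

(** * The polytope as a set of flows *)

Section flow_le_theory.
Variables (R : realType) (n : nat).
Implicit Types (x y : 'I_n -> R) (k : R).

Lemma eq_flow_le x y k : x =1 y -> flow_le x k -> flow_le y k.
Proof. by move=> xy [f [g [xE fk]]]; exists f, g; split=> // i; rewrite -xy. Qed.

Lemma flow_leW x k k' : k <= k' -> flow_le x k -> flow_le x k'.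
Proof. by move=> kk' [f [g [xE fk]]]; exists f, g; split=> //; apply: le_trans kk'. Qed.

Lemma flow_leD x y k k' :
  flow_le x k -> flow_le y k' -> flow_le (fun i => x i + y i) (k + k').
Proof.
move=> [f [g [xE fk]]] [f' [g' [yE fk']]].
exists (fun i => f i + f' i), (fun i => g i + g' i); split=> [i|].
  by rewrite xE yE; ring.
apply: le_trans (lerD fk fk'); rewrite -big_split; apply: ler_sum => i _ /=.
have := ler_normD (f i) (f' i); have := ler_normD (g i) (g' i); lra.
Qed.

Lemma flow_leZ a x k : flow_le x k -> flow_le (fun i => a * x i) (`|a| * k).
Proof.
move=> [f [g [xE fk]]]; exists (fun i => a * f i), (fun i => a * g i).
split=> [i|]; first by rewrite xE; ring.
apply: le_trans (ler_wpM2l (normr_ge0 a) fk); rewrite big_distrr.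
by apply: ler_sum => i _ /=; rewrite !normrM mulrDr.
Qed.

Lemma flow_le_spokes x : flow_le x (\sum_i `|x i|).
Proof.
exists (fun=> 0), x; split=> [i|]; first by rewrite addr0 subr0.
by apply: ler_sum => i _; rewrite normr0 add0r.
Qed.

Lemma flow_le_rim (i : 'I_n) :
  flow_le (fun j => (j == i)%:R - (j == ordS i)%:R : R) 1.
Proof.
exists (fun j => (j == i)%:R), (fun=> 0); split=> [j|].
  by rewrite add0r (can2_eq (@ord_predK n) (@ordSK n)).
rewrite (bigD1 i)//= big1; last by move=> j /negbTE ->; rewrite normr0 addr0.
by rewrite eqxx normr1 normr0 !addr0.
Qed.

End flow_le_theory.

Section convex_combination.
Local Open Scope classical_set_scope.
Variables (R : realType) (M : lmodType R) (B : set M).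
Hypotheses (cB : convex_set B) (B0 : B 0).

Lemma convex_comb2 (p : R) (x y : M) : 0 <= p -> p <= 1 -> B x -> B y ->
  B (p *: x + (1 - p) *: y).
Proof.
move=> p0 p1 Bx By.
by have := cB (Itv01 p0 p1) (mem_set Bx) (mem_set By) => /set_mem.
Qed.

(** The missing weight goes to the point 0. For the induction the bound 1 becomes any [t], and the
    sum is [t] times a point of [B]. *)
Lemma subconvex_comb (I : Type) (s : seq I) (a : I -> R) (v : I -> M) :
  (forall i, 0 <= a i) -> (forall i, B (v i)) -> \sum_(i <- s) a i <= 1 ->
  B (\sum_(i <- s) a i *: v i).
Proof.
move=> a0 Bv s1.
suff [b Bb ->] : exists2 b, B b & \sum_(i <- s) a i *: v i = 1 *: b by rewrite scale1r.
have : 0 <= 1 :> R by [].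
elim: s (1 : R) s1 => [|i s IH] t st t0; first by exists 0; rewrite // big_nil scaler0.
move: st; rewrite !big_cons => st.
have s0 : 0 <= \sum_(j <- s) a j by apply: sumr_ge0.
have [||b Bb ->] := IH (t - a i); [lra|lra|].
have [t00|tn0] := eqVneq t 0.
  have -> : a i = 0 by have := a0 i; lra.
  by exists 0; rewrite // t00 subrr !scale0r addr0.
have tp : 0 < t by rewrite lt_neqAle eq_sym tn0.
exists ((a i / t) *: v i + (1 - a i / t) *: b).
  by apply: convex_comb2; rewrite ?divr_ge0// ler_pdivrMr// mul1r; lra.
by rewrite scalerDr !scalerA; congr (_ *: _ + _ *: _); field.
Qed.

End convex_combination.

Section wheel_polytope.
Local Open Scope classical_set_scope.
Variables (R : realType) (n : nat).
Hypothesis n0 : (0 < n)%N.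
Notation V := (unit + 'I_n)%type.
Notation e := (@unit_vec R V).

Lemma sum_wheel (X : {ffun V -> R}) :
  \sum_v X v = X (inl tt) + \sum_i X (inr i).
Proof. by rewrite big_sumType /= (big_pred1 tt)// => -[]. Qed.

(** The zero sum determines the hub coordinate: rim flows cancel in the total, which leaves minus
    the sum of the spoke flows. *)
Lemma wheel_flow_decomposition (X : {ffun V -> R}) (f g : 'I_n -> R) :
  \sum_v X v = 0 -> (forall i, X (inr i) = g i + f i - f (ord_pred i)) ->
  X = \sum_i (f i *: (e (inr i) - e (inr (ordS i)))
              + g i *: (e (inr i) - e (inl tt))).
Proof.
move=> X0 XE; have Xc : X (inl tt) = - \sum_i g i.
  apply/eqP; rewrite -addr_eq0; apply/eqP; rewrite -[RHS]X0 sum_wheel; congr (_ + _).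
  rewrite [RHS](eq_bigr (fun i => g i + f i - f (ord_pred i))); last by move=> *; exact: XE.
  rewrite sumrB big_split /= -[X in _ - X]sum_ordS.
  by rewrite [X in _ - X](eq_bigr f) ?addrK// => i _; rewrite ordSK.
apply/ffunP => v; rewrite sum_ffunE.
under eq_bigr do rewrite !ffunE.
case: v => [[]|k].
  rewrite Xc -sumrN; apply: eq_bigr => i _.
  by rewrite eqxx /GRing.scale /=; ring.
rewrite XE [RHS](eq_bigr (fun i => f i * (k == i)%:R - f i * (k == ordS i)%:R
    + g i * (k == i)%:R)); last first.
  by move=> i _; rewrite /GRing.scale /= !(inj_eq (@inr_inj _ _)) /=; ring.
have S (h : 'I_n -> R) j : \sum_i h i * (j == i)%:R = h j.
  rewrite (bigD1 j)//= eqxx mulr1 big1 ?addr0// => i.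
  by rewrite eq_sym => /negbTE ->; rewrite mulr0.
rewrite big_split sumrB /= !S.
rewrite [X in _ - X + _](eq_bigr (fun i => f i * (ord_pred k == i)%:R)).
  by rewrite S; ring.
by move=> i _; rewrite (can2_eq (@ord_predK n) (@ordSK n)).
Qed.

Lemma wheel_polytopeP (X : {ffun V -> R}) :
  symmetric_edge_polytope (wheel n) X <->
  \sum_v X v = 0 /\ flow_le (fun i => X (inr i)) 1.
Proof.
split; last first.
  move=> [X0 [f [g [XE fg1]]]]; rewrite (wheel_flow_decomposition X0 XE).
  move=> B [cB AB].
  have Bopp u v (s : bool) : wheel n u v ->
      B ((if s then 1 else -1 : R) *: (e u - e v)).
    move=> uv; apply: AB; exists u, v; split=> //.
    by case: s; rewrite ?scale1r ?scaleN1r; [left|right].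
  have rim i : wheel n (inr i) (inr (ordS i)) by rewrite /wheel /= /cycle_graph eqxx.
  have spoke i : wheel n (inr i) (inl tt) by [].
  have B0 : B 0.
    have i0 : 'I_n := Ordinal n0.
    have -> : 0 = 2^-1 *: (1 *: (e (inr i0) - e (inl tt)))
        + (1 - 2^-1) *: (-1 *: (e (inr i0) - e (inl tt))).
      by rewrite !scalerA -scalerDl (_ : _ + _ = 0) ?scale0r//; lra.
    by apply: (convex_comb2 cB); [lra|lra|exact: (Bopp _ _ true)|exact: (Bopp _ _ false)].
  (* [true] indexes rim edges and [false] spokes. Absolute flows are the weights; the sign of the
     flow selects one of two opposite generators. *)
  pose a (p : bool * 'I_n) := if p.1 then `|f p.2| else `|g p.2|.
  pose sg (r : R) : R := if 0 <= r then 1 else -1.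
  pose v (p : bool * 'I_n) := if p.1 then sg (f p.2) *: (e (inr p.2) - e (inr (ordS p.2)))
     else sg (g p.2) *: (e (inr p.2) - e (inl tt)).
  have sgE r : `|r| * sg r = r.
    by rewrite /sg; case: lerP => r0; rewrite ?mulr1 ?mulrN1 ?(ger0_norm r0) ?(ltr0_norm r0) ?opprK.
  rewrite (_ : \sum_i _ = \sum_(p : bool * 'I_n) a p *: v p).
    apply: (subconvex_comb cB B0) => [[[] i]|[[] i]|]; rewrite /a /v //=; try exact: Bopp.
    rewrite -(pair_bigA _ (fun b i => if b then `|f i| else `|g i|)) /= big_bool /=.
    by rewrite -big_split.
  rewrite -(pair_bigA _ (fun b i => a (b, i) *: v (b, i))) /= big_bool /=.
  by rewrite -big_split; apply: eq_bigr => i _; rewrite /a /v /= !scalerA !sgE.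
(* By minimality of the hull it suffices that [B] is convex and contains the generators. *)
move=> PX; pose B := [set X : {ffun V -> R} | \sum_v X v = 0 /\ flow_le (fun i => X (inr i)) 1].
apply: (PX B); split=> /=.
  move=> x y l /set_mem[x0 xf] /set_mem[y0 yf]; apply/mem_set.
  have l0 : 0 <= l%:num by [].
  have l1 : l%:num <= 1 by [].
  have xyE v : (conv l x y : {ffun V -> R}) v = l%:num * x v + (1 - l%:num) * y v.
    by rewrite [conv l x y]/(l%:num *: (x : {ffun V -> R}) + (1 - l%:num) *: (y : {ffun V -> R})) !ffunE.
  split.
    rewrite (eq_bigr _ (fun v _ => xyE v)) big_split -!big_distrr /= x0 y0; ring.
  apply: (@eq_flow_le _ _ (fun i => l%:num * x (inr i) + (1 - l%:num) * y (inr i))).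
    by move=> i; rewrite xyE.
  have := flow_leD (flow_leZ l%:num xf) (flow_leZ (1 - l%:num) yf).
  by apply: flow_leW; rewrite !ger0_norm ?subr_ge0//; lra.
have Bopp X' : B X' -> B (- X').
  move=> [X0 Xf]; split.
    by rewrite (eq_bigr (fun v => - X' v)) ?sumrN ?X0 ?oppr0// => v _; rewrite ffunE.
  have := flow_leZ (-1) Xf; rewrite normrN1 mul1r.
  by apply: eq_flow_le => i; rewrite ffunE mulN1r.
suff BE u v : wheel n u v -> B (e u - e v).
  by move=> x [u [v [uv [->|->]]]]; [|apply: Bopp]; exact: BE.
have sum0 u' v' : \sum_x (e u' - e v') x = 0.
  rewrite (eq_bigr (fun x => (x == u')%:R - (x == v')%:R)); last by move=> x _; rewrite !ffunE.
  have S (w : V) : \sum_x (x == w)%:R = 1 :> R.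
    by rewrite (bigD1 w)//= eqxx big1 ?addr0// => x /negbTE ->.
  by rewrite sumrB !S subrr.
have spoke i : B (e (inr i) - e (inl tt)).
  split=> //; have := flow_le_spokes (fun j : 'I_n => (j == i)%:R : R).
  rewrite (bigD1 i)//= eqxx normr1 big1 ?addr0; last by move=> j /negbTE ->; rewrite normr0.
  by apply: eq_flow_le => j; rewrite !ffunE subr0.
have rim i : B (e (inr i) - e (inr (ordS i))).
  by split=> //; apply: eq_flow_le (flow_le_rim R i) => j; rewrite !ffunE.
case: u v => [[]|i] [[]|j] uv; first by [].
- by rewrite -opprB; exact/Bopp/spoke.
- exact: spoke.
- by case/orP: uv => /eqP ->; [exact: rim|rewrite -opprB; exact/Bopp/rim].
Qed.

End wheel_polytope.

(** * Asymptotics *)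

Lemma leq_exp_base m n e : (m <= n -> m ^ e <= n ^ e)%N.
Proof. by case: e => // e mn; rewrite leq_exp2r. Qed.

Lemma ffact_le_exp m n : (m ^_ n <= m ^ n)%N.
Proof.
elim: n => [|n IH]; first by rewrite ffactn0.
by rewrite ffactnSr expnSr leq_mul// leq_subr.
Qed.

Lemma ffact_ge_exp m n : ((m - n) ^ n <= m ^_ n)%N.
Proof.
elim: n => [|n IH]; first by rewrite ffactn0.
rewrite ffactnSr expnSr leq_mul//; last by lia.
by apply: leq_trans IH; apply: leq_exp_base; lia.
Qed.

Section asymptotics.
Local Open Scope classical_set_scope.
Variable R : realType.

Lemma cvg_perturbed_power (v a : R) n :
  (fun k => v * (1 + a * harmonic k) ^+ n) @ \oo --> v.
Proof.
suff: (fun k => v * (1 + a * harmonic k) ^+ n) @ \oo --> v * (1 + a * 0) ^+ n.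
  by rewrite mulr0 addr0 expr1n mulr1.
apply: cvgM; first exact: cvg_cst.
apply: (@cvg_comp _ _ _ (fun k => 1 + a * harmonic k) (fun x : R => x ^+ n) _
  (nbhs (1 + a * 0))); last exact: exprn_continuous.
apply: cvgD; first exact: cvg_cst.
by apply: cvgM; [exact: cvg_cst|exact: cvg_harmonic].
Qed.

Lemma squeeze_binomial (l : \bar R) (v n c : nat) :
  (forall k, (0 < k)%N -> (l <= ((v * 'C(n + (k + c), n))%:R / k%:R ^+ n)%:E)%E) ->
  (forall k, (0 < k)%N -> (c + n <= k)%N ->
    (((v * 'C(k - c, n))%:R / k%:R ^+ n)%:E <= l)%E) ->
  (n`!%:R%:E * l)%E = v%:R%:E.
Proof.
move=> ub lb.
have lfin : l \is a fin_num.
  rewrite fin_numE; apply/andP; split; apply/eqP => lE.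
    by have := lb (c + n).+1 isT (leqnSn _); rewrite lE.
  by have := ub 1%N isT; rewrite lE.
rewrite -(fineK lfin) in ub lb *; set r := fine l in ub lb *.
rewrite -EFinM; congr EFin; apply/eqP; rewrite eq_le; apply/andP; split.
  (* The falling factorial is at most [(k + n + c)^n], which gives the perturbation [(n + c) / k].
     Since [harmonic k] is the inverse of [k.+1], the bound is taken at [k.+1]. *)
  have := @cvg_perturbed_power v%:R (n + c)%:R n.
  move=> /cvgr_to_ge; apply; apply: nearW => k.
  have k0 : 0 < k.+1%:R :> R by rewrite ltr0n.
  have := ub k.+1 isT; rewrite lee_fin ler_pdivlMr ?exprn_gt0// => H.
  rewrite /harmonic -[leRHS](mulfK (lt0r_neq0 (exprn_gt0 n k0))) ler_pdivlMr ?exprn_gt0//.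
  rewrite -[leRHS]mulrA -exprMn mulrDl mul1r mulfVK ?gt_eqF//.
  rewrite -mulrA; apply: le_trans (ler_wpM2l _ H) _ => //.
  rewrite -natrM -natrD -natrX -natrM ler_nat mulnCA leq_mul// mulnC bin_ffact.
  by apply: leq_trans (ffact_le_exp _ _) _; apply: leq_exp_base; lia.
(* Here the falling factorial is at least [(k - c - n)^n]. *)
have := @cvg_perturbed_power v%:R (- (n + c)%:R) n.
move=> /cvgr_to_le; apply.
near=> k.
have k0 : 0 < k.+1%:R :> R by rewrite ltr0n.
have ck : (c + n <= k.+1)%N by near: k; exists (c + n)%N => // k /= /leq_trans; apply.
have := lb k.+1 isT ck; rewrite lee_fin ler_pdivrMr ?exprn_gt0// => H.
rewrite /harmonic -[leLHS](mulfK (lt0r_neq0 (exprn_gt0 n k0))) ler_pdivrMr ?exprn_gt0//.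
rewrite -[leLHS]mulrA -exprMn mulrDl mul1r !mulNr mulfVK ?gt_eqF//.
rewrite -mulrA; apply: le_trans (ler_wpM2l _ H) => //.
rewrite addnC -natrB// -natrX -!natrM ler_nat mulnCA leq_mul// mulnC bin_ffact.
by apply: leq_trans (ffact_ge_exp _ _); apply: leq_exp_base; lia.
Unshelve. all: by end_near. Qed.

End asymptotics.

(** * Volume *)

Section lattice_coordinates.
Variables (R : realType) (n d : nat) (b : 'I_d -> {ffun unit + 'I_n -> R}).
Hypothesis hb : is_lattice_basis (@zero_sum_lattice R (unit + 'I_n)%type) b.

(** The point with lattice coordinates [t], without its hub coordinate, which the zero sum
    restores. *)
Definition rim_part (t : 'I_d -> R) (i : 'I_n) : R := \sum_j t j * b j (inr i).

Lemma rim_partE (t : 'I_d -> R) i : (\sum_j t j *: b j) (inr i) = rim_part t i.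
Proof. by rewrite sum_ffunE; apply: eq_bigr => j _; rewrite ffunE. Qed.

Lemma sum_comb0 (t : 'I_d -> R) : \sum_v (\sum_j t j *: b j) v = 0.
Proof.
under eq_bigr do rewrite sum_ffunE.
rewrite exchange_big big1// => j _ /=.
under eq_bigr do rewrite ffunE.
by rewrite -big_distrr /= (hb.1 j).2 mulr0.
Qed.

Lemma sum_mulrzE (z : {ffun 'I_d -> int}) :
  \sum_j b j *~ z j = \sum_j (z j)%:~R *: b j.
Proof. by apply: eq_bigr => j _; rewrite scaler_int. Qed.

Lemma lattice_coordinates_exist (x : 'I_n -> int) :
  exists z : {ffun 'I_d -> int},
    forall i, rim_part (fun j => (z j)%:~R) i = (x i)%:~R.
Proof.
pose X : {ffun unit + 'I_n -> R} :=
  [ffun v => match v with inl _ => - \sum_i (x i)%:~R | inr i => (x i)%:~R end].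
have [|z [Xz _]] := hb.2 X.
  split=> [[u|i]|]; rewrite ?ffunE ?rpredN ?rpred_sum// => *; rewrite ?intr_int//.
  rewrite sum_wheel ffunE [X in _ + X](eq_bigr (fun i => (x i)%:~R)) ?addNr//.
  by move=> i _; rewrite ffunE.
by exists z => i; rewrite -rim_partE -sum_mulrzE -Xz ffunE.
Qed.

Lemma rim_part_int (z : 'I_d -> int) i :
  rim_part (fun j => (z j)%:~R) i \is a Num.int.
Proof. by apply: rpred_sum => j _; rewrite rpredM ?intr_int// (hb.1 j).1. Qed.

Lemma lattice_coordinates_unique (z z' : {ffun 'I_d -> int}) :
  rim_part (fun j => (z j)%:~R) =1 rim_part (fun j => (z' j)%:~R) -> z = z'.
Proof.
move=> zz'; pose X := \sum_j (z j)%:~R *: b j.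
have XL : zero_sum_lattice X.
  split=> [v|]; last exact: sum_comb0.
  rewrite sum_ffunE; apply: rpred_sum => j _.
  by rewrite ffunE rpredM ?intr_int// (hb.1 j).1.
have [y [_ yuniq]] := hb.2 X XL.
rewrite -(yuniq z) ?sum_mulrzE//; apply: yuniq; rewrite sum_mulrzE.
have E i : X (inr i) = (\sum_j (z' j)%:~R *: b j) (inr i) by rewrite !rim_partE zz'.
apply/ffunP => -[[]|i]; last exact: E.
(* Adding the common rim sum turns both hub coordinates into full coordinate sums, which are 0. *)
apply: (@addIr _ (\sum_i X (inr i))).
rewrite -sum_wheel sum_comb0 (eq_bigr _ (fun i _ => E i)) -sum_wheel.
by rewrite sum_comb0.
Qed.

Lemma wheel_polytope_comb (n0 : (0 < n)%N) (t : 'I_d -> R) :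
  symmetric_edge_polytope (wheel n) (\sum_j t j *: b j) <-> flow_le (rim_part t) 1.
Proof.
split=> [/(wheel_polytopeP n0)[_]|Ft]; last apply/(wheel_polytopeP n0).
  by apply: eq_flow_le => i; rewrite rim_partE.
by split; [exact: sum_comb0|apply: eq_flow_le Ft => i; rewrite rim_partE].
Qed.

(** Rounding lattice coordinates changes the cost by at most a constant that depends only on the
    basis. *)
Lemma flow_le_rim_part (t : 'I_d -> R) : (forall j, `|t j| <= 1) ->
  flow_le (rim_part t) (\sum_i \sum_j `|b j (inr i)|).
Proof.
move=> t1; apply: flow_leW (flow_le_spokes _); apply: ler_sum => i _.
apply: le_trans (ler_norm_sum _ _ _) _; apply: ler_sum => j _.
by rewrite normrM ler_piMl.
Qed.

Lemma rim_partD (s t : 'I_d -> R) i :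
  rim_part (fun j => s j + t j) i = rim_part s i + rim_part t i.
Proof. by rewrite -big_split; apply: eq_bigr => j _; rewrite mulrDl. Qed.

Lemma rim_partZ a (t : 'I_d -> R) i :
  rim_part (fun j => a * t j) i = a * rim_part t i.
Proof. by rewrite /rim_part big_distrr; apply: eq_bigr => j _ /=; rewrite mulrA. Qed.

End lattice_coordinates.

Section wheel_volume.
Local Open Scope classical_set_scope.
Variables (R : realType) (n d : nat) (b : 'I_d -> {ffun unit + 'I_n -> R}).
Hypotheses (n1 : (1 < n)%N)
  (hb : is_lattice_basis (@zero_sum_lattice R (unit + 'I_n)%type) b).

Let n0 : (0 < n)%N := ltnW n1.

Let Q : set (d.-tuple R) :=
  [set t | symmetric_edge_polytope (wheel n) (\sum_(i < d) tnth t i *: b i)].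

Let V := #|[set w : {ffun 'I_n -> letter} | valid_word w]%SET|.

(** Bounding each entry by [K], which the bound on the sum implies anyway, makes the type finite. *)
Let codes K := ({w : {ffun 'I_n -> letter} | valid_word w} *
  {c : n.-tuple 'I_K.+1 | (\sum_(i <- c) i <= K)%N})%type.

Let card_codes K : #|{: codes K}| = (V * 'C(n + K, n))%N.
Proof.
by rewrite card_prod !card_sig -card_partial_ord_partitions /V !cardsE.
Qed.

Section level.
Variables (k c0 : nat).
Hypotheses (k0 : (0 < k)%N) (c0P : \sum_i \sum_j `|b j (inr i)| <= c0%:R :> R).

Let fl (t : d.-tuple R) : {ffun 'I_d -> int} :=
  [ffun j => Num.floor (k%:R * tnth t j)].

(** The sign [s] allows passing from a point to its rounding and back. *)
Let frac_flow (t : d.-tuple R) s : `|s| = 1 ->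
  flow_le (rim_part b (fun j => s * (k%:R * tnth t j - (fl t j)%:~R))) c0%:R.
Proof.
move=> s1; apply: flow_leW c0P _; apply: flow_le_rim_part => j.
rewrite normrM s1 mul1r ffunE; have /andP[] := floor_itv (k%:R * tnth t j).
by rewrite intrD ler_norml; lra.
Qed.

(** Rounding [k t] down gives a lattice point of cost at most [k + c0], hence a code; every point of
    [Q] thus lies in the box of some code. *)
Lemma volume_upper_bound :
  (lebesgue_tuple R d Q <= ((V * 'C(n + (k + c0), n))%:R / k%:R ^+ d)%:E)%E.
Proof.
have [zof zofP] := choice (lattice_coordinates_exist hb).
rewrite -card_codes.
apply: (lebesgue_tuple_le_boxes k0 (z := fun p : codes (k + c0) =>
  zof (demand (val p.1) (fun i => tnth (val p.2) i)))) => t.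
move=> /(wheel_polytope_comb hb n0) Ft.
have [x xE] : exists x : 'I_n -> int, forall i,
    rim_part b (fun j => (fl t j)%:~R) i = (x i)%:~R.
  exists (fun i => Num.floor (rim_part b (fun j => (fl t j)%:~R) i)) => i.
  by rewrite floorK// rim_part_int.
have Fx : flow_le (fun i => (x i)%:~R : R) (k + c0)%:R.
  have := flow_leD (flow_leZ k%:R Ft) (frac_flow t (normrN1 R)).
  rewrite mulr1 normr_nat -natrD; apply: eq_flow_le => i.
  rewrite -rim_partZ -rim_partD -xE; congr rim_part.
  by apply/funext => j; ring.
have [w vw [c cE]] := code_exists n1 x.
have cK : (\sum_i c i <= k + c0)%N.
  rewrite -(ler_nat R); apply: (demand_flow_min vw).
  by apply: eq_flow_le Fx => i; rewrite cE.
have ciK i : (c i < (k + c0).+1)%N.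
  by rewrite ltnS (leq_trans _ cK)// (bigD1 i)//= leq_addr.
pose u := [tuple Ordinal (ciK i) | i < n].
have uE : (fun i => val (tnth u i)) = c by apply/funext => i; rewrite tnth_mktuple.
have uK : (\sum_(i <- u) i <= k + c0)%N.
  rewrite big_tuple (eq_bigr c)// => i _; by rewrite tnth_mktuple.
exists (exist _ w vw, exist _ u uK) => /=; apply/(in_grid_box k0) => j.
rewrite uE (_ : zof _ = fl t) ?ffunE//.
apply: (lattice_coordinates_unique hb) => i.
by rewrite zofP xE cE.
Qed.

Lemma volume_lower_bound : (c0 + n <= k)%N ->
  (((V * 'C(k - c0, n))%:R / k%:R ^+ d)%:E <= lebesgue_tuple R d Q)%E.
Proof.
move=> ck; have [zof zofP] := choice (lattice_coordinates_exist hb).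
have -> : (k - c0 = n + (k - c0 - n))%N by lia.
set K := (k - c0 - n)%N; rewrite -card_codes.
(* Raising each entry by 1 makes it positive, so distinct codes give distinct boxes. It adds [n] to
   the cost, which stays at most [k - c0], so the whole box lies in [Q]. *)
pose x (p : codes K) := demand (val p.1) (fun i => (tnth (val p.2) i).+1).
apply: (lebesgue_tuple_ge_boxes k0 (z := fun p => zof (x p))).
  move=> [[w vw] [c cK]] [[w' vw'] [c' cK']] zz.
  have [||||i|wE cE] := @demand_inj n w w' (fun i => (tnth c i).+1) (fun i => (tnth c' i).+1) => //.
    apply/eqP; rewrite -(eqr_int R) -[demand w _ i]/(x (exist _ w vw, exist _ c cK) i).
    rewrite -[demand w' _ i]/(x (exist _ w' vw', exist _ c' cK') i) -!zofP.
    apply/eqP; congr rim_part; apply/funext => j; congr (_ %:~R); exact: zz.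
  congr pair; apply: val_inj => //=.
  by apply: eq_from_tnth => i; apply: val_inj; have := cE i => -[].
move=> [[w vw] [c cK]] t /(in_grid_box k0) tz; apply/(wheel_polytope_comb hb n0).
have flE : fl t = zof (x (exist _ w vw, exist _ c cK)).
  by apply/ffunP => j; rewrite ffunE tz.
have Fx : flow_le (rim_part b (fun j => (fl t j)%:~R)) (k%:R - c0%:R).
  have := demand_flow R (fun i => (tnth c i).+1) (andP vw).1.
  move=> /flow_leW => /(_ (k%:R - c0%:R))/(_ _)/(eq_flow_le _); apply.
    by move=> i; rewrite flE zofP.
  rewrite -natrB ?ler_nat; last by lia.
  rewrite (eq_bigr (fun i => tnth c i + 1)%N); last by move=> i _; rewrite addn1.
  rewrite big_split sum1_card card_ord /=; have := cK.
  by rewrite big_tuple -(leq_add2r n) => /leq_trans; apply; rewrite /K; lia.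
have := flow_leZ k%:R^-1 (flow_leD Fx (frac_flow t (normr1 R))).
have kR : k%:R != 0 :> R by rewrite pnatr_eq0 -lt0n.
rewrite subrK normfV normr_nat mulVf//; apply: eq_flow_le => i.
rewrite -rim_partD -rim_partZ; congr rim_part; apply/funext => j.
by rewrite mul1r addrC subrK mulKf.
Qed.

End level.

Lemma wheel_volume : d = n ->
  (n`!%:R%:E * lebesgue_tuple R d Q)%E = V%:R%:E.
Proof.
move=> dn; pose c0 := Num.bound (\sum_i \sum_j `|b j (inr i)| : R).
have c0P : \sum_i \sum_j `|b j (inr i)| <= c0%:R :> R.
  by apply: ltW; apply: archi_boundP; apply: sumr_ge0 => i _; exact: sumr_ge0.
apply: (@squeeze_binomial R _ _ _ c0) => k k0.
  by rewrite -[X in _ ^+ X]dn; exact: volume_upper_bound.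
by rewrite -[X in _ ^+ X]dn; exact: volume_lower_bound.
Qed.

End wheel_volume.

Theorem theorem4p24 (R : realType) (n : nat) (hn : (3 <= n)%N)
    (b : 'I_#|{: unit + 'I_n}|.-1 -> {ffun unit + 'I_n -> R})
    (hb : is_lattice_basis (@zero_sum_lattice R (unit + 'I_n)%type) b) :
  normalized_volume b (@symmetric_edge_polytope R (unit + 'I_n)%type (wheel n)) =
  (if odd n then (1 - Num.sqrt 3) ^+ n + (1 + Num.sqrt 3) ^+ n
   else (1 - Num.sqrt 3) ^+ n + (1 + Num.sqrt 3) ^+ n - 2)%:E.
Proof.
have n1 : (1 < n)%N by apply: ltnW.
have dn : #|{: unit + 'I_n}|.-1 = n by rewrite card_sum card_unit card_ord.
by rewrite -card_valid_word// -(wheel_volume n1 hb dn) /normalized_volume {1}dn.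
Qed.
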